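(* Let $a\ge2$ and $1\le b<a$ be integers. The golden sieve on $a\mathbb{N}+b$ and Kimberling's rank transform of the block sequence $u_{a,b}$ produce the same complementary pair. More precisely, if $R(u_{a,b})=(r_n)_{n\ge1}$ denotes the rank transform of $u_{a,b}$ and $c_n:=n+a\,r_n+(b-1)$, then for all $n\ge1$ $$(\sigma_n,\delta_n)=(r_n,c_n),\qquad\text{and}\qquad \{r_n:n\ge1\}\sqcup\{c_n:n\ge1\}=\mathbb{N}.$$
   Context: $\mathbb{N}=\{1,2,3,\ldots\}$ and $a\mathbb{N}+b=\{an+b:n\ge1\}$, viewed as an increasing sequence. For a strictly increasing sequence $X$ of positive integers, $X(k)$ denotes its $k$-th term; $\sqcup$ denotes disjoint union. Golden sieve: let $W_0=(w_1<w_2<\cdots)$ be an infinite strictly increasing sequence of positive integers. For $n\ge1$ define inductively $h_n:=W_{n-1}(n)$ (the pointer), $d_n:=W_{n-1}(h_n)$ (the deletion), and let $W_n$ be the increasing sequence obtained from $W_{n-1}$ by removing the value $d_n$. The survivor sequence $(s_n)_{n\ge1}$ is the increasing enumeration of $W_0\setminus\{d_1,d_2,\ldots\}$. For $W_0=a\mathbb{N}+b$ the normalized sequences are $\sigma_n:=(s_n-b)/a$ and $\delta_n:=(d_n-b)/a$. Block sequence: $u_{a,b}(n)=\max\bigl(0,\lceil (n-b+1)/a\rceil\bigr)$ for $n\ge1$; equivalently, $b-1$ copies of $0$ followed by exactly $a$ copies of each integer $m\ge1$ in order. Rank transform: let $u=(u_n)_{n\ge1}$ be a nondecreasing sequence of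 nonnegative integers and $r=(r_n)_{n\ge1}$ an increasing sequence of positive integers. Put $\tilde h(1):=u_1$ and $\tilde h(n):=\#\{i: r_i\in[u_{n-1},u_n)\}$ for $n\ge2$, and define $T_u(r)=(r'_n)$ by $r'_1:=1$ and $r'_n:=r_{n-1}+\tilde h(n)+1$ for $n\ge2$. If $T_u(r)=r$, then $r$ is called the rank transform of $u$, written $r=R(u)$. *)

(* Defs.v *)
From mathcomp Require Import all_boot all_order all_algebra.
From mathcomp Require Import finmap boolp classical_sets cardinality.

Set Implicit Arguments.
Unset Strict Implicit.
Unset Printing Implicit Defensive.
Import Order.TTheory GRing.Theory Num.Theory.

Local Open Scope classical_set_scope.
Local Open Scope ring_scope.

(* A sequence (x_n)_{n >= 1} is a function [nat -> nat] whose value at index 0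
   is never used. *)

Definition posints : set nat := [set n | (1 <= n)%N].

Definition strictly_increasing (x : nat -> nat) : Prop :=
  forall m n, (1 <= m)%N -> (m < n)%N -> (x m < x n)%N.

Definition terms (x : nat -> nat) : set nat := x @` posints.

Definition increasing_enumeration (A : set nat) (x : nat -> nat) : Prop :=
  strictly_increasing x /\ terms x = A.

(* If W is strictly increasing and v is one of its terms, this is the
   increasing sequence of the terms of W other than v. *)
Definition remove_value (W : nat -> nat) (v : nat) : nat -> nat :=
  fun k => if (W k < v)%N then W k else W k.+1.

(* The successor case inlines [deletion W0 n.+1] = W_n(W_n(n+1)). *)
Fixpoint sieve (W0 : nat -> nat) (n : nat) : nat -> nat :=
  if n is m.+1 then
    let W := sieve W0 m in remove_value W (W (W m.+1))
  else W0.

Definition pointer (W0 : nat -> nat) (n : nat) : nat := sieve W0 n.-1 n.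

Definition deletion (W0 : nat -> nat) (n : nat) : nat :=
  sieve W0 n.-1 (pointer W0 n).

Definition survivor_sequence (W0 s : nat -> nat) : Prop :=
  increasing_enumeration (terms W0 `\` terms (deletion W0)) s.

Definition arith (a b : nat) : nat -> nat := fun n => (a * n + b)%N.

(* Taken in [rat], so that neither the subtraction nor the division truncates. *)
Definition normalize (a b x : nat) : rat := (x%:R - b%:R) / a%:R.

Definition block (a b n : nat) : nat :=
  absz (Num.max 0 (Num.ceil ((n%:R - b%:R + 1) / a%:R : rat))).

(* The set counted for n >= 2 is finite as soon as r is strictly increasing,
   which [is_rank_transform] requires. *)
Definition htilde (u r : nat -> nat) (n : nat) : nat :=
  if (n <= 1)%N then u 1%N
  else #|` fset_set [set i | (1 <= i)%N /\ (u n.-1 <= r i < u n)%N]|%fset.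

Definition rankT (u r : nat -> nat) (n : nat) : nat :=
  if (n <= 1)%N then 1%N else (r n.-1 + htilde u r n + 1)%N.

Definition is_rank_transform (u r : nat -> nat) : Prop :=
  [/\ strictly_increasing r,
      forall n, (1 <= n)%N -> (1 <= r n)%N
    & forall n, (1 <= n)%N -> rankT u r n = r n].

(* Main.v *)
(* Write h_j = a r_j + b.  The rank transform of the block sequence and the
   normalized survivor sequence obey the same recursion
   r_n = n + #{j : h_j <= n}, in which only terms r_j with j < n are involved.
   For the former, [u_(n-1), u_n) contains r_j exactly when h_j = n.  For the
   latter, the pointers h_j increase and h_j > j, so deletions never reach back
   to settled positions and W_k(n) = a (n + #{j <= k : h_j <= n}) + b.  The
   integer that r skips at the index n = h_j is r_n - 1 = h_j + j - 1 = c_j,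
   which is also the normalized j-th deletion. *)
Require Import Defs.
From mathcomp Require Import all_boot all_order all_algebra.
From mathcomp Require Import finmap boolp classical_sets cardinality.
From mathcomp Require Import zify.

Set Implicit Arguments.
Unset Strict Implicit.
Unset Printing Implicit Defensive.
Import Order.TTheory GRing.Theory Num.Theory.

Lemma increasing_enumeration_unique (A : set nat) (x y : nat -> nat) :
  increasing_enumeration A x -> increasing_enumeration A y ->
  forall n, 1 <= n -> x n = y n.
Proof.
(* By symmetry one inequality suffices. The value [t n] is some [z k]; if [k < n], the two sequences
   agree at [k] and [t] would repeat a value. *)
suff le_xy z t n : increasing_enumeration A z -> increasing_enumeration A t ->
    1 <= n -> (forall k, k < n -> 1 <= k -> z k = t k) -> z n <= t n.
  move=> Ax Ay n; elim/ltn_ind: n => n IHn n1.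
  apply/eqP; rewrite eqn_leq; apply/andP; split; apply: le_xy => // k kn k1.
  by rewrite IHn.
move=> [z_incr Az] [t_incr At] n1 zt.
have : terms z (t n) by rewrite Az -At; exists n.
case=> k k1 zk; rewrite -zk; move: k1; rewrite /posints /= => k1.
case: (ltngtP k n) => [kn||->] //; last by move=> /(z_incr _ _ n1) /ltnW.
by have := t_incr _ _ k1 kn; rewrite -zk -zt // ltnn.
Qed.

(** * Counting the terms of a sequence below a bound *)

Definition count_upto (h : nat -> nat) (N n : nat) : nat :=
  count (fun j => h j <= n) (iota 1 N).

Lemma count_uptoS h N n :
  count_upto h N.+1 n = count_upto h N n + (h N.+1 <= n).
Proof.
by rewrite /count_upto -(addn1 N) iotaD count_cat /= add1n addn1 addn0.
Qed.

Lemma count_upto_size h N n : count_upto h N n <= N.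
Proof. by rewrite -[leqRHS](size_iota 1) count_size. Qed.

Lemma leq_count_upto h N M m n :
  N <= M -> m <= n -> count_upto h N m <= count_upto h M n.
Proof.
move=> /subnKC <- mn; rewrite /count_upto iotaD count_cat.
by apply: leq_trans (leq_addr _ _); apply: sub_count => j /leq_trans; apply.
Qed.

(** Since [h] increases, the indices counted form an initial segment of [1..N]. *)
Lemma leq_count_uptoE h N n k : strictly_increasing h -> 1 <= k <= N ->
  (k <= count_upto h N n) = (h k <= n).
Proof.
move=> h_incr /andP[k1 kN]; have h_le i j : 1 <= i -> i <= j -> h i <= h j.
  by move=> i1; rewrite leq_eqVlt => /predU1P[->//|/h_incr -/(_ i1)/ltnW].
case: (leqP (h k) n) => hkn.
  apply: (leq_trans _ (leq_count_upto h kN (leqnn n))).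
  rewrite -{1}(size_iota 1 k) /count_upto (eq_in_count (a2 := predT)).
    by rewrite count_predT.
  by move=> j; rewrite mem_iota /= => jk; have := h_le j k; lia.
apply/negbTE; rewrite -ltnNge -(prednK k1) ltnS.
rewrite /count_upto -(subnKC (leq_trans (leq_pred k) kN)) iotaD count_cat.
rewrite (@eq_in_count _ _ pred0 (iota (1 + k.-1) _)) ?count_pred0 ?addn0.
  exact: count_upto_size.
by move=> j; rewrite mem_iota /= => jk; have := h_le k j; lia.
Qed.

Lemma count_upto_full h N n : strictly_increasing h -> h N.+1 <= n ->
  count_upto h N n = N.
Proof.
move=> h_incr hn; apply/eqP; rewrite eqn_leq count_upto_size /=.
have := @leq_count_uptoE h N.+1 n N.+1 h_incr (leqnn _).
by rewrite count_uptoS hn addn1 ltnS.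
Qed.

(** For [k > n] both sides fail, because [h k > k]; so [k] needs no upper bound. *)
Lemma leq_count_upto_diagE h n k :
    strictly_increasing h -> (forall j, 1 <= j -> j < h j) -> 1 <= k ->
  (k <= count_upto h n n) = (h k <= n).
Proof.
move=> h_incr h_gt k1; case: (leqP k n) => kn.
  by rewrite leq_count_uptoE ?k1.
by have := count_upto_size h n n; have := h_gt k k1; lia.
Qed.

Definition affine_image (a b : nat) (r : nat -> nat) (j : nat) : nat :=
  a * r j + b.

Definition self_counting (a b : nat) (r : nat -> nat) : Prop :=
  forall n, 1 <= n -> r n = n + count_upto (affine_image a b r) n n.

(** * The golden sieve in terms of a self-counting sequence *)

Section SelfCounting.

Variables (a b : nat) (a2 : 2 <= a) (b1 : 1 <= b).

(** Each value depends on all earlier ones, so the recursion carries the whole list. Leaving the new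
    index out of the count is harmless, its pointer being too large. *)
Fixpoint self_counting_prefix (n : nat) : seq nat :=
  if n is m.+1 then
    let s := self_counting_prefix m in
    rcons s (n + count (fun x => a * x + b <= n) s)
  else [::].

Lemma self_counting_exists : exists r, self_counting a b r.
Proof.
pose r n := last 0 (self_counting_prefix n); exists r.
have rS n : r n.+1 =
    n.+1 + count (fun x => a * x + b <= n.+1) (self_counting_prefix n).
  by rewrite /r /= last_rcons.
have prefixE n : self_counting_prefix n = map r (iota 1 n).
  elim: n => // n IHn.
  by rewrite -[in RHS](addn1 n) iotaD map_cat -IHn cats1 add1n rS.
case=> // n _; rewrite count_uptoS leqNgt.
have -> : n.+1 < affine_image a b r n.+1 by rewrite /affine_image rS; nia.
by rewrite addn0 rS prefixE count_map.
Qed.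

Variables (r : nat -> nat) (r_sc : self_counting a b r).

Local Notation h := (affine_image a b r).
Local Notation C := (fun n => count_upto h n n).

Lemma self_counting_incr : strictly_increasing r.
Proof.
move=> m n m1 mn; rewrite (r_sc m1) (r_sc (leq_trans m1 (ltnW mn))).
by have := leq_count_upto h (ltnW mn) (ltnW mn); lia.
Qed.

Lemma pointer_incr : strictly_increasing h.
Proof.
by move=> m n m1 mn; rewrite /affine_image; have := self_counting_incr m1 mn; nia.
Qed.

Lemma pointer_gt j : 1 <= j -> j < h j.
Proof. by move=> j1; rewrite /affine_image (r_sc j1); nia. Qed.

Lemma leq_countE n k : 1 <= k -> (k <= C n) = (h k <= n).
Proof. exact: leq_count_upto_diagE pointer_incr pointer_gt. Qed.

(** With the closed form below, this identifies the [n]-th pointer of the sieve as [h n]. *)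
Lemma count_pointer_pred n : 1 <= n -> n + count_upto h n.-1 n = r n.
Proof.
case: n => // n _; rewrite r_sc // count_uptoS.
by rewrite [h n.+1 <= _]leqNgt pointer_gt // addn0.
Qed.

Lemma sieve_closed_form n k : 1 <= k ->
  sieve (arith a b) n k = a * (k + count_upto h n k) + b.
Proof.
have cnt_size := count_upto_size h.
elim: n k => [|n IHn] k k1 /=; first by rewrite /arith addn0.
have hn := pointer_gt (ltn0Sn n).
have hE : a * r n.+1 + b = h n.+1 by [].
rewrite /remove_value [sieve _ n n.+1]IHn // (count_pointer_pred (ltn0Sn n)) hE.
have full := count_upto_full pointer_incr.
rewrite !IHn //; last by lia.
rewrite [count_upto h n (h _)]full // count_uptoS.
(* The deleted value sits at position [h n.+1], where all [n] earlier pointers count. From there on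
   positions shift by one; before it they are unchanged. *)
have := cnt_size n k; case: (leqP (h n.+1) k) => hk.
  by rewrite !full //; last lia; case: ifP; nia.
by case: ifP; nia.
Qed.

Lemma deletionE n : 1 <= n ->
  deletion (arith a b) n = a * (n + h n - 1) + b.
Proof.
case: n => // n _; rewrite /deletion /pointer /=.
rewrite [sieve _ n n.+1]sieve_closed_form // (count_pointer_pred (ltn0Sn n)).
have hn := pointer_gt (ltn0Sn n); have hE : a * r n.+1 + b = h n.+1 by [].
rewrite hE sieve_closed_form; last by lia.
rewrite (count_upto_full pointer_incr (leqnn _)) -hE; nia.
Qed.

(** If [h n <= m], at least [n] pointers count and [r m >= h n + n]; otherwise at most [n - 1] do
    and [r m <= h n + n - 2]. *)
Lemma self_counting_disjoint m n : 1 <= m -> 1 <= n -> r m <> n + h n - 1.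
Proof.
move=> m1 n1; rewrite (r_sc m1).
by have := leq_countE m n1; lia.
Qed.

Lemma self_counting_cover v : 1 <= v ->
  (exists2 m, 1 <= m & r m = v) \/ (exists2 j, 1 <= j & j + h j - 1 = v).
Proof.
move=> v1; have r_ge n : 1 <= n -> n <= r n.
  by move=> n1; rewrite (r_sc n1) leq_addr.
have r1 : r 1 = 1.
  by rewrite r_sc // count_uptoS leqNgt pointer_gt.
have ex_m : exists m, (1 <= m) && (r m <= v) by exists 1; rewrite r1.
have m_le m : (1 <= m) && (r m <= v) -> m <= v.
  by move=> /andP[/r_ge rm]; exact: leq_trans.
case: (ex_maxnP ex_m m_le) => m /andP[m1 rmv] m_max.
have vr : v < r m.+1 by rewrite ltnNge; apply/negP => /(m_max m.+1); rewrite ltnn.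
move: rmv; rewrite leq_eqVlt => /predU1P[<-|rmv]; first by left; exists m.
(* The value [v] lies strictly between [r m] and [r m.+1], so some pointer equals [m.+1]. It is the
   first one not counted at [m], and strict growth of [h] makes it the only one, whence
   [v = r m + 1]. *)
right; exists (C m).+1 => //.
have := leq_countE m (ltn0Sn (C m)).
have := leq_countE m.+1 (ltn0Sn (C m)).
have := leq_countE m.+1 (ltn0Sn (C m).+1).
have := pointer_incr (ltn0Sn (C m)) (ltnSn (C m).+1).
by move: rmv vr; rewrite (r_sc m1) (r_sc (ltn0Sn m)); lia.
Qed.

(** Disjointness shows that no pointer value is deleted, covering that nothing else survives. *)
Lemma survivor_self_counting : survivor_sequence (arith a b) h.
Proof.
split; first exact: pointer_incr.
apply/seteqP; split => v.
  case=> m m1 <-; split.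
    by exists (r m) => //; rewrite /posints /= in m1 *; rewrite r_sc //; lia.
  case=> n n1; rewrite deletionE // => /eqP.
  rewrite eqn_add2r eqn_pmul2l; last by lia.
  by move=> /eqP/esym; exact: self_counting_disjoint.
case=> -[k k1 <-] ndel; case: (self_counting_cover k1) => -[m m1 mk].
  by exists m => //; rewrite /affine_image mk.
by case: ndel; exists m => //; rewrite deletionE // mk.
Qed.

End SelfCounting.

(** * The rank transform of the block sequence *)

Lemma block_leE a b n m : 1 <= a -> (block a b n <= m) = (n < a * m + b).
Proof.
move=> a1; rewrite /block.
set x : rat := (_ / _)%R.
(* Truncation at 0 does not matter, as [m] is a natural number. *)
have -> : (`|Num.max 0%R (Num.ceil x)| <= m)%N = (Num.ceil x <= m%:Z)%R by lia.
rewrite Num.Theory.ceil_le_int /x ler_pdivrMr ?ltr0n // -pmulrn -natrM.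
by rewrite addrAC lerBlDr natr1 -natrD ler_nat; lia.
Qed.

Lemma htilde_block a b r n : 2 <= a -> 1 <= b -> 2 <= n ->
    (forall i, 1 <= i -> i <= r i) ->
  htilde (block a b) r n = count (fun j => affine_image a b r j == n) (iota 1 n).
Proof.
move=> a2 b1 n2 r_ge; have a1 : 1 <= a by lia.
rewrite /htilde leqNgt n2 /= -size_filter.
set s := filter _ _.
have -> : ([set i | (1 <= i)%N /\ (block a b n.-1 <= r i < block a b n)%N]
          = [set` [fset i in s]%fset])%classic.
  (* By [block_leE], membership says [n.-1 < a * r i + b <= n]; with [i <= r i] this forces
     [i <= n]. *)
  apply/seteqP; split=> i; rewrite /= !inE mem_filter mem_iota.
    rewrite [(_ < block _ _ _)%N]ltnNge !block_leE // => -[i1 /andP[? ?]].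
    by have := r_ge i i1; rewrite /affine_image; nia.
  rewrite [(_ < block _ _ _)%N]ltnNge !block_leE // /affine_image.
  by move=> /andP[/eqP ? /andP[? ?]]; split=> //; lia.
by rewrite set_fsetK card_fseq undup_id // filter_uniq // iota_uniq.
Qed.

Lemma count_upto_diagS h n : n.+1 < h n.+1 ->
  count_upto h n.+1 n.+1 =
  count_upto h n n + count (fun j => h j == n.+1) (iota 1 n.+1).
Proof.
move=> hn; have -> : count_upto h n n = count_upto h n.+1 n.
  by rewrite count_uptoS leqNgt (ltnW hn) addn0.
rewrite /count_upto -[RHS]count_predUI.
rewrite [X in _ + X](eq_count (a2 := pred0)) ?count_pred0 ?addn0.
  by apply: eq_count => j /=; rewrite leq_eqVlt ltnS orbC.
by move=> j /=; lia.
Qed.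

Lemma strictly_increasing_ge (x : nat -> nat) :
  strictly_increasing x -> 1 <= x 1 -> forall n, 1 <= n -> n <= x n.
Proof.
move=> x_incr x1; elim=> // -[|n] IHn _ //.
exact: leq_ltn_trans (IHn _) (x_incr _ _ _ (ltnSn _)).
Qed.

(** The rank recursion is the difference of two consecutive self-counting equations; both start at 1
    because no pointer is at most 1. *)
Lemma rank_transformP a b r : 2 <= a -> 1 <= b ->
  is_rank_transform (block a b) r <-> self_counting a b r.
Proof.
move=> a2 b1; pose h := affine_image a b r.
have hS n : (forall i, 1 <= i -> i <= r i) -> n.+1 < h n.+1.
  by move=> /(_ n.+1 isT); rewrite /h /affine_image; nia.
have C1 : (forall i, 1 <= i -> i <= r i) -> count_upto h 1 1 = 0.
  by move=> /(hS 0) h1; rewrite count_uptoS leqNgt h1.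
split=> [[r_incr r1 rT] n|sc].
  have r_ge := strictly_increasing_ge r_incr (r1 1 isT).
  elim: n => // -[|n] IHn _; first by rewrite -rT // C1.
  rewrite -rT // /rankT /= htilde_block // (IHn isT).
  by rewrite [in RHS]count_upto_diagS; [rewrite /h; lia|exact: hS].
have r_ge i : 1 <= i -> i <= r i by move=> i1; rewrite sc // leq_addr.
split; first exact: self_counting_incr sc.
  by move=> n n1; apply: leq_trans n1 (r_ge n n1).
move=> [//|[|n]] _; first by rewrite sc // C1.
rewrite /rankT /= htilde_block // !sc //.
by rewrite [in RHS]count_upto_diagS; [lia|exact: hS].
Qed.

Local Open Scope classical_set_scope.
Local Open Scope ring_scope.

Lemma normalizeE (a b x : nat) : (1 <= a)%N -> normalize a b (a * x + b) = x%:R.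
Proof.
move=> a1; rewrite /normalize natrD addrK natrM mulrAC divff ?mul1r //.
by rewrite pnatr_eq0 -lt0n.
Qed.

Theorem theorem4p12 (a b : nat) (ha : (2 <= a)%N) (hb : (1 <= b < a)%N) :
  [/\ exists r : nat -> nat, is_rank_transform (block a b) r,
      exists s : nat -> nat, survivor_sequence (arith a b) s
    & forall r s : nat -> nat,
        is_rank_transform (block a b) r ->
        survivor_sequence (arith a b) s ->
        let c := fun n : nat => (n + a * r n + (b - 1))%N in
        [/\ forall n : nat, (1 <= n)%N ->
              (normalize a b (s n), normalize a b (deletion (arith a b) n))
              = ((r n)%:R, (c n)%:R),
            terms r `|` terms c = posints
          & terms r `&` terms c = set0]].
Proof.
have [b1 _] := andP hb; have a1 := ltnW ha.
have [r0 sc0] := self_counting_exists ha b1.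
split; first by exists r0; apply/rank_transformP.
  by eexists; exact: survivor_self_counting ha b1 _ sc0.
move=> r s /(rank_transformP _ ha b1) sc s_surv c.
have cE n : c n = (n + affine_image a b r n - 1)%N.
  by rewrite /c /affine_image; lia.
split.
- move=> n n1; rewrite (deletionE ha b1 sc n1) !normalizeE //.
  (* The given [s] must be the pointer sequence, whose normalization is [r]. *)
  have -> := increasing_enumeration_unique s_surv
    (survivor_self_counting ha b1 sc) n1.
  by rewrite normalizeE // cE.
- apply/seteqP; split=> v; last first.
    by case/(self_counting_cover ha b1 sc) => -[m m1 <-]; [left|right];
      exists m; rewrite ?cE.
  by case=> -[m m1 <-]; rewrite /posints /= ?/c in m1 *; rewrite ?sc //; lia.
- apply/seteqP; split=> // v [[m m1 <-] [n n1]]; rewrite cE => /esym.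
  by move=> /(self_counting_disjoint ha b1 sc m1 n1).
Qed.
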